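(* For every $n\ge 3$: $s_n^0(123,132,231)=\left\lfloor\frac n2\right\rfloor$, $s_n^1(123,132,231)=\left\lfloor\frac n2\right\rfloor+(-1)^{n+1}$, $s_n^2(123,132,231)=\frac12\left(1+(-1)^n\right)$, and $s_n^k(123,132,231)=0$ for all $3\le k\le n$.
   Context: $S_n$ denotes the set of permutations of $\{1,\dots,n\}$ written in one-line notation $\pi=\pi_1\pi_2\cdots\pi_n$. For $\alpha\in S_m$, $\pi\in S_n$ contains the pattern $\alpha$ if there are indices $i_1<i_2<\dots<i_m$ such that $\pi_{i_1}\pi_{i_2}\cdots\pi_{i_m}$ is order-isomorphic to $\alpha$; otherwise $\pi$ avoids $\alpha$. For a set $T$ of patterns, $S_n^k(T)$ is the set of $\pi\in S_n$ that have exactly $k$ fixed points (indices $i$ with $\pi_i=i$) and avoid every pattern in $T$; $s_n^k(T)=|S_n^k(T)|$. The braces around $T$ are omitted, e.g. $s_n^k(123,132,231)=s_n^k(\{123,132,231\})$. *)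

(* Defs.v *)
From mathcomp Require Import all_boot all_fingroup.

Set Implicit Arguments.
Unset Strict Implicit.
Unset Printing Implicit Defensive.

Import GroupScope.

(* 'S_n acts on {0, .., n-1}; [oneline] shifts back to the usual one-line
   notation over {1, .., n}. *)
Definition oneline n (s : 'S_n) : seq nat := [seq (s i).+1 | i <- enum 'I_n].

Definition contains m n (a : 'S_m) (s : 'S_n) : bool :=
  [exists f : {ffun 'I_m -> 'I_n},
     [forall i : 'I_m, forall j : 'I_m, (i < j) ==> (f i < f j)] &&
     [forall i : 'I_m, forall j : 'I_m, (s (f i) < s (f j)) == (a i < a j)]].

Definition avoids m n (a : 'S_m) (s : 'S_n) : bool := ~~ contains a s.

Definition pattern : Type := {m : nat & 'S_m}.

Definition fixpoints n (s : 'S_n) : {set 'I_n} := [set i | s i == i].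

(* The list T stands for the set of its members: patterns of any lengths, whose
   order and repetitions do not matter. *)
Definition Savoid (n k : nat) (T : seq pattern) : {set 'S_n} :=
  [set s : 'S_n | (#|fixpoints s| == k) &&
                  all (fun a : pattern => avoids (tagged a) s) T].

Definition savoid (n k : nat) (T : seq pattern) : nat := #|Savoid n k T|.

Definition perm123 : 'S_3 := 1.
Definition perm132 : 'S_3 := tperm (inord 1) (inord 2).
(* Products of permutations act left factor first. *)
Definition perm231 : 'S_3 := tperm (inord 0) (inord 1) * tperm (inord 0) (inord 2).

Lemma oneline123 : oneline perm123 = [:: 1; 2; 3]%N.
Proof. by rewrite /oneline !enum_ordSl enum_ord0 /= !perm1. Qed.

Lemma oneline132 : oneline perm132 = [:: 1; 3; 2]%N.
Proof.
have E1 : inord 1 = @Ordinal 3 1 isT by apply: val_inj; rewrite /= inordK.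
have E2 : inord 2 = @Ordinal 3 2 isT by apply: val_inj; rewrite /= inordK.
by rewrite /oneline !enum_ordSl enum_ord0 /= /perm132 E1 E2 !permE.
Qed.

Lemma oneline231 : oneline perm231 = [:: 2; 3; 1]%N.
Proof.
have E0 : inord 0 = @Ordinal 3 0 isT by apply: val_inj; rewrite /= inordK.
have E1 : inord 1 = @Ordinal 3 1 isT by apply: val_inj; rewrite /= inordK.
have E2 : inord 2 = @Ordinal 3 2 isT by apply: val_inj; rewrite /= inordK.
rewrite /oneline !enum_ordSl enum_ord0 /= /perm231 E0 E1 E2 !permM.
by rewrite !permE /=.
Qed.

Definition pat123 : pattern := Tagged (fun m => 'S_m) perm123.
Definition pat132 : pattern := Tagged (fun m => 'S_m) perm132.
Definition pat231 : pattern := Tagged (fun m => 'S_m) perm231.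

(* Main.v *)
Require Import Defs.
From mathcomp Require Import all_boot all_order all_fingroup all_algebra.
From mathcomp Require Import zify.

Import GRing.Theory.
Local Open Scope ring_scope.

(** The three patterns 123, 132 and 231 are exactly those whose first two
    entries form an ascent. Hence an ascent s i < s j with i < j, j not the
    last position, always creates one of them when the last position is taken
    as the third index: which one depends on how the last entry compares with
    s i and s j. So avoiding all three means being decreasing on all positions
    but the last ([avoid_decreasing]), and such a permutation is determined by
    its last entry ([decreasing_decr_then]): in S_(n+1) there are n+1 of them,
    one for each last value v, with positions and values counted from 0.

    In the permutation with last value v, position n is fixed when v = n. The
    decreasing part sends k < n to n - k when v <= n - 1 - k, since it has to
    skip the value v, and to n - 1 - k otherwise; only the middle position
    k = n./2 can be fixed, and it is so when v > n./2 for odd n, when v < n./2 for even n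
    ([card_fixpoints_decr_then]). Hence there are at most two fixed points, and
    each count of the theorem is the size of an interval of values v, possibly
    with the value n added. *)

(** * Patterns of length three *)

Lemma oneline_nth n (s : 'S_n) (i : 'I_n) : nth 0%N (oneline s) i = (s i).+1.
Proof. by rewrite (nth_map i) ?size_enum_ord // nth_ord_enum. Qed.

Lemma perm_ord_neq n (s : 'S_n) (i j : 'I_n) :
  i <> j :> nat -> s i <> s j :> nat.
Proof. by move=> ij /ord_inj /perm_inj ij'; rewrite ij' in ij. Qed.

(** The pattern enters through its one-line notation only, so that the three
    patterns are handled alike. Comparing the three pairs of positions
    p < q is enough: the entries of a permutation are distinct, so the
    comparisons of the pairs p > q follow. *)
Lemma contains3P n (a : 'S_3) (s : 'S_n) (x y z : nat) :
  oneline a = [:: x; y; z] ->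
  reflect (exists i j k : 'I_n,
             [/\ (i < j < k)%N, (s i < s j)%N = (x < y)%N,
                 (s i < s k)%N = (x < z)%N & (s j < s k)%N = (y < z)%N])
          (contains a s).
Proof.
move=> a_xyz.
have aE (p q : 'I_3) : (a p < a q)%N =
    (nth 0 [:: x; y; z] p < nth 0 [:: x; y; z] q)%N.
  by rewrite -a_xyz !oneline_nth ltnS.
apply: (iffP existsP) => [[f /andP[/forallP fmono /forallP fpat]]|].
  pose p0 := @Ordinal 3 0 isT; pose p1 := @Ordinal 3 1 isT.
  pose p2 := @Ordinal 3 2 isT.
  have mono (p q : 'I_3) : (p < q)%N -> (f p < f q)%N
    by apply/implyP/(forallP (fmono p)).
  have pat (p q : 'I_3) := eqP (forallP (fpat p) q).
  exists (f p0), (f p1), (f p2).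
  by split; [rewrite !mono | rewrite pat aE ..].
move=> [i [j [k [/andP[ij jk] sij sik sjk]]]].
have aneq (p q : 'I_3) : (p != q)%N ->
    nth 0%N [:: x; y; z] p <> nth 0%N [:: x; y; z] q.
  by move=> /eqP pq; rewrite -a_xyz !oneline_nth => -[] /ord_inj /perm_inj.
have xy := aneq (@Ordinal 3 0 isT) (@Ordinal 3 1 isT) isT.
have xz := aneq (@Ordinal 3 0 isT) (@Ordinal 3 2 isT) isT.
have yz := aneq (@Ordinal 3 1 isT) (@Ordinal 3 2 isT) isT.
have sij' : s i <> s j :> nat by apply: perm_ord_neq; lia.
have sjk' : s j <> s k :> nat by apply: perm_ord_neq; lia.
have sik' : s i <> s k :> nat by apply: perm_ord_neq; lia.
rewrite /= in xy xz yz.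
exists [ffun p : 'I_3 => nth i [:: i; j; k] p].
apply/andP; split; apply/forallP => p; apply/forallP => q; rewrite ?aE !ffunE.
  by move: p q => [[|[|[|?]]] ?] [[|[|[|?]]] ?] //=; lia.
by apply/eqP; move: p q => [[|[|[|?]]] ?] [[|[|[|?]]] ?] //=; lia.
Qed.

(** * Avoiding permutations *)

(** An ascent before the last position is the start of one of the three
    patterns, and each of the three starts with such an ascent. *)
Lemma avoid_decreasing n (s : 'S_n.+1) :
  all (fun a : pattern => avoids (tagged a) s) [:: pat123; pat132; pat231] <->
  (forall i j : 'I_n.+1, (i < j < n)%N -> (s j < s i)%N).
Proof.
rewrite /= andbT /avoids; split.
  move=> /and3P[/(contains3P _ _ _ _ _ _ oneline123) no123
    /(contains3P _ _ _ _ _ _ oneline132) no132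
    /(contains3P _ _ _ _ _ _ oneline231) no231] i j /andP[ij jn].
  have sij : s i <> s j :> nat by apply: perm_ord_neq; lia.
  have sjm : s j <> s ord_max :> nat by apply: perm_ord_neq => /=; lia.
  have sim : s i <> s ord_max :> nat by apply: perm_ord_neq => /=; lia.
  rewrite ltnNge; apply/negP => le_ij.
  have ijm : (i < j < @ord_max n)%N by rewrite ij.
  have [lt_jm|le_mj] := ltnP (s j) (s ord_max).
    by apply: no123; exists i, j, ord_max; split=> //; lia.
  have [lt_im|le_mi] := ltnP (s i) (s ord_max).
    by apply: no132; exists i, j, ord_max; split=> //; lia.
  by apply: no231; exists i, j, ord_max; split=> //; lia.
move=> dec.
have noasc (a : 'S_3) x y z : (x < y)%N -> oneline a = [:: x; y; z] ->
    ~~ contains a s.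
  move=> xy a_xyz; apply/(contains3P _ _ _ _ _ _ a_xyz).
  move=> [i [j [k [ijk sij _ _]]]]; have kn := ltn_ord k.
  rewrite xy in sij; have := dec i j; lia.
by apply/and3P; split; apply: noasc; [|exact: oneline123| |exact: oneline132|
  |exact: oneline231].
Qed.

(** [lift_perm] sends the last position to v and spreads the reversal of
    'I_n over the remaining positions and values, in increasing order. *)
Definition decr_then n (v : 'I_n.+1) : 'S_n.+1 :=
  lift_perm ord_max v (perm (@rev_ord_inj n)).

Lemma decr_then_last n (v : 'I_n.+1) : decr_then n v ord_max = v.
Proof. exact: lift_perm_id. Qed.

Lemma decr_then_lift n (v : 'I_n.+1) (i : 'I_n) :
  decr_then n v (lift ord_max i) = bump v (n - i.+1) :> nat.
Proof. by rewrite /decr_then lift_perm_lift permE. Qed.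

Lemma decr_then_inj n : injective (decr_then n).
Proof. by move=> v w vw; rewrite -(decr_then_last _ v) vw decr_then_last. Qed.

Lemma card_ord_interval N a b :
  (b <= N)%N -> #|[set v : 'I_N | (a <= v < b)%N]| = (b - a)%N.
Proof.
move=> bN; rewrite -sum1_card.
rewrite (eq_bigl (fun v : 'I_N => (a <= v)%N && (v < b)%N)) => [|v];
  last by rewrite inE.
rewrite -(@big_ord_widen_cond _ 0%N addn b N (fun v => a <= v)%N (fun=> 1%N)) //.
rewrite -(@big_geq_mkord _ 0%N addn a b xpredT (fun=> 1%N)).
by rewrite sum_nat_const_nat muln1.
Qed.

Lemma card_perm_lt n (s : 'S_n) (x : nat) :
  (x <= n)%N -> #|[set j | (s j < x)%N]| = x.
Proof.
move=> xn; rewrite -[RHS]subn0 -(card_ord_interval n 0 x xn).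
rewrite -[RHS](card_preimset _ (@perm_inj _ s)).
by apply: eq_card => j; rewrite !inE.
Qed.

(** In an s that decreases on the positions below n, the entry at position
    k < n equals, as in any permutation, the number of smaller entries. These are the ones at positions strictly between k and n, and also
    the last one, v, if v < s k. So s k is n - 1 - k plus the bit (v < s k),
    and as s k <> v this says s k = bump v (n - 1 - k). *)
Lemma decreasing_decr_then n (s : 'S_n.+1) :
  (forall i j : 'I_n.+1, (i < j < n)%N -> (s j < s i)%N) <->
  s = decr_then n (s ord_max).
Proof.
split=> [dec|->]; last first.
  move=> i j /andP[ij jn].
  case: (unliftP ord_max j) => [j'|] ej; last by rewrite ej ltnn in jn.
  case: (unliftP ord_max i) => [i'|] ei; last first.
    by move: (ltn_trans ij jn); rewrite ei ltnn.
  move: ij; rewrite ei ej !decr_then_lift !lift_max.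
  move: (ltn_ord i') (ltn_ord j'); rewrite -[n.+1.-1]/n /bump; lia.
apply/permP => i; apply: ord_inj.
case: (unliftP ord_max i) => [i'|] ->; last by rewrite decr_then_last.
change 'I_n in i'.
rewrite decr_then_lift; set k := lift _ _; set v := s ord_max.
have kE : k = i' :> nat by rewrite lift_max.
clearbody k.
have i'n : (i' < n)%N := ltn_ord i'.
have vk : s k <> v :> nat by apply: perm_ord_neq; rewrite kE /=; lia.
have lt_k j : (s j < s k)%N = (k < j < n)%N || (v < s k)%N && (j == ord_max).
  have [->|jm] := eqVneq j ord_max; first by rewrite /= ltnn andbF andbT.
  have jn : (j < n)%N.
    by have := ltn_ord j; rewrite ltnS leq_eqVlt -[j == n :> nat]/(j == ord_max)
      (negbTE jm).
  rewrite jn andbF andbT orbF.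
  have [kj|jk|ejk] := ltngtP k j; first by rewrite dec ?kj.
    by apply/negbTE; rewrite -leqNgt ltnW // dec // jk kE.
  by rewrite (ord_inj ejk) ltnn.
have := card_perm_lt _ s (s k) (ltnW (ltn_ord _)).
have -> : [set j | (s j < s k)%N] =
    [set j : 'I_n.+1 | (k.+1 <= j < n)%N] :|:
    (if (v < s k)%N then [set ord_max] else set0).
  apply/setP => j; rewrite inE lt_k !inE.
  by case: ifP => _; rewrite !inE.
case: ifP => v_lt.
  rewrite setUC cardsU1 !inE /= ltnn andbF card_ord_interval // kE /bump; lia.
rewrite setU0 card_ord_interval // kE /bump; lia.
Qed.

(** * Fixed points *)

Definition nfix_decr_then (n v : nat) : nat :=
  (v == n) + (if odd n then n./2 < v else v < n./2)%N.

(** A fixed k < n solves k = bump v (n - 1 - k), so 2k is n - 1 or n,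
    the latter exactly when v <= n - 1 - k. Either way k = n./2, and the parity
    of n decides which inequality on v is needed. *)
Lemma card_fixpoints_decr_then n (v : 'I_n.+1) :
  (0 < n)%N -> #|fixpoints (decr_then n v)| = nfix_decr_then n v.
Proof.
move=> n_gt0; have half_lt : (n./2 < n)%N by lia.
pose c := lift ord_max (Ordinal half_lt).
have cE : c = n./2 :> nat by rewrite lift_max.
have c_max : (ord_max == c) = false.
  by rewrite -(inj_eq val_inj) -[val c]/(nat_of_ord c) cE /=; lia.
set b := if odd n then (n./2 < v)%N else (v < n./2)%N.
have -> : fixpoints (decr_then n v) =
    (if v == ord_max then [set ord_max] else set0) :|:
    (if b then [set c] else set0).
  apply/setP => i; rewrite !inE.
  have -> : (i \in if v == ord_max then [set ord_max] else set0) =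
      (v == ord_max) && (i == ord_max) by case: ifP; rewrite inE.
  have -> : (i \in if b then [set c] else set0) = b && (i == c).
    by case: ifP; rewrite inE.
  case: (unliftP ord_max i) => [i'|] ->.
    change 'I_n in i'; have i'n : (i' < n)%N := ltn_ord i'.
    rewrite -(inj_eq val_inj) -[val _]/(nat_of_ord _) decr_then_lift.
    rewrite -![lift _ _ == _](inj_eq val_inj) /=.
    by rewrite /b /bump; case: ifP; lia.
  rewrite decr_then_last eqxx andbT; case: eqP => //= _.
  by rewrite c_max andbF.
rewrite /nfix_decr_then -/b -[v == n :> nat]/(v == ord_max).
case: eqP => _; case: b; rewrite ?setU0 ?set0U ?cards0 ?cards1 //.
by rewrite cards2 c_max.
Qed.

Lemma savoid_decr_then n k : (0 < n)%N ->
  savoid n.+1 k [:: pat123; pat132; pat231] =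
  #|[set v : 'I_n.+1 | nfix_decr_then n v == k]|.
Proof.
move=> n_gt0; rewrite /savoid -(card_imset _ (decr_then_inj n)).
apply: eq_card => s; rewrite inE; apply/andP/imsetP.
  move=> [sk /avoid_decreasing/decreasing_decr_then sE].
  exists (s ord_max) => //.
  by rewrite inE -card_fixpoints_decr_then // -sE.
move=> [v]; rewrite inE => /eqP <- ->; rewrite card_fixpoints_decr_then //.
by split=> //; apply/avoid_decreasing/decreasing_decr_then; rewrite decr_then_last.
Qed.

(** * The four counts *)

Lemma savoid0 n : (0 < n)%N ->
  savoid n.+1 0 [:: pat123; pat132; pat231] = (n.+1)./2.
Proof.
move=> n_gt0; rewrite savoid_decr_then //.
(* The last values v that give no fixed point are those in the interval from
   a to b, b excluded. *)
pose a := if odd n then 0%N else n./2.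
pose b := if odd n then (n./2).+1 else n.
have -> : [set v : 'I_n.+1 | nfix_decr_then n v == 0%N] =
    [set v : 'I_n.+1 | (a <= v < b)%N].
  apply/setP => v; rewrite !inE /nfix_decr_then /a /b; have := ltn_ord v.
  case: ifP; lia.
by rewrite card_ord_interval /a /b; case: ifP; lia.
Qed.

Lemma savoid1 n : (0 < n)%N ->
  savoid n.+1 1 [:: pat123; pat132; pat231] =
  if odd n then (n./2)%N else (n./2).+1.
Proof.
move=> n_gt0; rewrite savoid_decr_then //; case: ifP => odd_n.
  have -> : [set v : 'I_n.+1 | nfix_decr_then n v == 1%N] =
      [set v : 'I_n.+1 | ((n./2).+1 <= v < n)%N].
    apply/setP => v; rewrite !inE /nfix_decr_then odd_n; have := ltn_ord v; lia.
  by rewrite card_ord_interval; lia.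
have -> : [set v : 'I_n.+1 | nfix_decr_then n v == 1%N] =
    ord_max |: [set v : 'I_n.+1 | (0 <= v < n./2)%N].
  apply/setP => v; rewrite !inE /nfix_decr_then odd_n -val_eqE /=.
  have := ltn_ord v; lia.
rewrite cardsU1 card_ord_interval ?inE /=; lia.
Qed.

Lemma savoid2 n : (0 < n)%N ->
  savoid n.+1 2 [:: pat123; pat132; pat231] = odd n.
Proof.
move=> n_gt0; rewrite savoid_decr_then //.
have -> : [set v : 'I_n.+1 | nfix_decr_then n v == 2%N] =
    if odd n then [set ord_max] else set0.
  apply/setP => v; rewrite inE /nfix_decr_then.
  by case: ifP => odd_n; rewrite !inE -?val_eqE /=; have := ltn_ord v; lia.
by case: (odd n); rewrite ?cards1 ?cards0.
Qed.

Lemma savoid_ge3 n k : (0 < n)%N -> (3 <= k)%N ->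
  savoid n.+1 k [:: pat123; pat132; pat231] = 0%N.
Proof.
move=> n_gt0 k_ge3; rewrite savoid_decr_then //; apply: eq_card0 => v.
rewrite !inE /nfix_decr_then; case: ifP; lia.
Qed.

Theorem theorem3p3 (n : nat) (n_ge3 : (3 <= n)%N) :
  [/\ savoid n 0 [:: pat123; pat132; pat231] = (n %/ 2)%N,
      (savoid n 1 [:: pat123; pat132; pat231])%:Z
        = (n %/ 2)%N%:Z + (-1) ^+ n.+1,
      (savoid n 2 [:: pat123; pat132; pat231])%:R
        = 1 / 2%:R * (1 + (-1) ^+ n) :> rat
    & forall k : nat, (3 <= k <= n)%N ->
        savoid n k [:: pat123; pat132; pat231] = 0%N].
Proof.
case: n n_ge3 => // n n_ge2; have n_gt0 : (0 < n)%N by lia.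
rewrite savoid0 // savoid1 // savoid2 // divn2; split=> //.
- rewrite -signr_odd /= negbK.
  case: (boolP (odd n)) => odd_n; rewrite ?expr1 ?expr0; lia.
- by rewrite -signr_odd /=; case: (odd n).
- by move=> k /andP[k_ge3 _]; apply: savoid_ge3.
Qed.
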